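(* Let $A$ be a $C^*$-algebra, $H$ a Hilbert $A$-module, and let $P,Q\in\mathcal{L}(H)$ be two harmonious projections. Then $$\big\Vert PQ\big(I-P_{\mathcal{R}(P)\cap\mathcal{R}(Q)}\big)\big\Vert=\big\Vert(I-P)(I-Q)\big(I-P_{\mathcal{N}(P)\cap\mathcal{N}(Q)}\big)\big\Vert.$$
   Context: $\mathcal{L}(H)$ is the $C^*$-algebra of adjointable operators on the Hilbert $A$-module $H$; a projection is $P\in\mathcal{L}(H)$ with $P=P^2=P^*$; $\mathcal{R}$ and $\mathcal{N}$ denote range and null space. A closed submodule $M\subseteq H$ is orthogonally complemented in $H$ if $H=M+M^\perp$, where $M^\perp=\{x\in H:\langle x,y\rangle=0\ \forall y\in M\}$; then $P_M$ denotes the projection in $\mathcal{L}(H)$ with range $M$. Two projections $P,Q\in\mathcal{L}(H)$ are harmonious if $\overline{\mathcal{R}(P+Q)}$, $\overline{\mathcal{R}(P+I-Q)}$, $\overline{\mathcal{R}(I-P+Q)}$, $\overline{\mathcal{R}(I-P+I-Q)}$ are all orthogonally complemented in $H$. In that case $\mathcal{R}(P)\cap\mathcal{R}(Q)=\overline{\mathcal{R}(2I-P-Q)}^\perp$ and $\mathcal{N}(P)\cap\mathcal{N}(Q)=\overline{\mathcal{R}(P+Q)}^\perp$ are orthogonally complemented, so the projections in the claim are meaningful. *)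

(* Defs.v *)
From HB Require Import structures.
From mathcomp Require Import all_boot all_order all_algebra.
From mathcomp Require Import all_classical all_reals all_analysis.
From mathcomp Require Export complex.

Set Implicit Arguments.
Unset Strict Implicit.
Unset Printing Implicit Defensive.

Import Order.TTheory GRing.Theory Num.Theory.
Import numFieldNormedType.Exports.

Local Open Scope classical_set_scope.
Local Open Scope ring_scope.
Local Open Scope complex_scope.

(* A C*-algebra need not be unital, so it is not built on the ring structures
   of the library, which all have a unit. *)
HB.mixin Record isCStarAlgebra (R : realType) A
    of CompleteNormedModule R[i] A := {
  cmul : A -> A -> A ;
  cstar : A -> A ;
  cmulA : forall a b c, cmul a (cmul b c) = cmul (cmul a b) c ;
  cmulDl : forall a b c, cmul (a + b) c = cmul a c + cmul b c ;
  cmulDr : forall a b c, cmul a (b + c) = cmul a b + cmul a c ;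
  cmulZl : forall (z : R[i]) a b, cmul (z *: a) b = z *: cmul a b ;
  cmulZr : forall (z : R[i]) a b, cmul a (z *: b) = z *: cmul a b ;
  cnormM : forall a b, `|cmul a b| <= `|a| * `|b| ;
  cstarK : forall a, cstar (cstar a) = a ;
  cstarD : forall a b, cstar (a + b) = cstar a + cstar b ;
  cstarZ : forall (z : R[i]) a, cstar (z *: a) = Num.conj z *: cstar a ;
  cstarM : forall a b, cstar (cmul a b) = cmul (cstar b) (cstar a) ;
  cnorm_star : forall a, `|cmul (cstar a) a| = `|a| ^+ 2
}.

#[short(type="cstarAlgType")]
HB.structure Definition CStarAlgebra (R : realType) :=
  { A of isCStarAlgebra R A & CompleteNormedModule R[i] A }.

Definition cpositive (R : realType) (A : cstarAlgType R) (a : A) : Prop :=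
  exists b : A, a = cmul (cstar b) b.

(* Right modules, with an inner product that is linear in its second
   argument.  The field hnormE says that the norm, for which the module is
   complete, is |x| = |<x, x>|^(1/2). *)
HB.mixin Record isHilbertModule (R : realType) (A : cstarAlgType R) H
    of CompleteNormedModule R[i] H := {
  hact : H -> A -> H ;
  hdot : H -> H -> A ;
  hactDl : forall x y a, hact (x + y) a = hact x a + hact y a ;
  hactDr : forall x a b, hact x (a + b) = hact x a + hact x b ;
  hactM : forall x a b, hact x (cmul a b) = hact (hact x a) b ;
  hactZl : forall (z : R[i]) x a, hact (z *: x) a = z *: hact x a ;
  hactZr : forall (z : R[i]) x a, hact x (z *: a) = z *: hact x a ;
  hdotDr : forall x y z, hdot x (y + z) = hdot x y + hdot x z ;
  hdotZr : forall (c : R[i]) x y, hdot x (c *: y) = c *: hdot x y ;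
  hdot_act : forall x y a, hdot x (hact y a) = cmul (hdot x y) a ;
  hdot_star : forall x y, cstar (hdot x y) = hdot y x ;
  hdot_ge0 : forall x, cpositive (hdot x x) ;
  hdot_eq0 : forall x, hdot x x = 0 -> x = 0 ;
  hnormE : forall x, `|x| ^+ 2 = `|hdot x x|
}.

#[short(type="hilbertModType")]
HB.structure Definition HilbertModule (R : realType) (A : cstarAlgType R) :=
  { H of isHilbertModule R A H & CompleteNormedModule R[i] H }.

Section Operators.
Variables (R : realType) (A : cstarAlgType R) (H : hilbertModType A).
Implicit Types (T S P Q : H -> H) (M : set H).

(* An adjoint is unique when it exists: is_adjoint T S means T^* = S. *)
Definition is_adjoint T S : Prop :=
  forall x y : H, hdot (T x) y = hdot x (S y) :> A.

(* Membership in L(H); A-linearity and boundedness are consequences. *)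
Definition adjointable T : Prop := exists S, is_adjoint T S.

(* Adjointable maps are bounded, so this supremum is the norm of L(H). *)
Definition opnorm T : R :=
  sup [set complex.Re `|T x| | x in [set x : H | `|x| <= 1]].

Definition projection P : Prop :=
  [/\ adjointable P, P \o P = P & is_adjoint P P].

Definition null_space T : set H := [set x | T x = 0].

Definition orthogonal M : set H :=
  [set x | forall y, M y -> hdot x y = 0 :> A].

Definition orthogonally_complemented M : Prop :=
  [set x + y | x in M & y in orthogonal M] = setT.

(* P_M: the projection with range M, which is unique.  The default value idfun
   is only taken when M is not orthogonally complemented. *)
Definition proj_on M : H -> H :=
  xget (T := (H -> H)%type) idfun [set P | projection P /\ range P = M].

Definition harmonious P Q : Prop :=
  [/\ orthogonally_complemented (closure (range (P \+ Q))),
      orthogonally_complemented (closure (range (P \+ (idfun \- Q)))),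
      orthogonally_complemented (closure (range ((idfun \- P) \+ Q))) &
      orthogonally_complemented
        (closure (range ((idfun \- P) \+ (idfun \- Q))))].

End Operators.

(* Main.v *)
From HB Require Import structures.
Require Import Defs.
From mathcomp Require Import all_boot all_order all_algebra.
From mathcomp Require Import all_classical all_reals all_analysis.
From mathcomp Require Import ring lra.
Import Order.TTheory GRing.Theory Num.Theory.
Import numFieldNormedType.Exports.
Local Open Scope classical_set_scope.
Local Open Scope ring_scope.
Set Implicit Arguments.
Unset Strict Implicit.
Unset Printing Implicit Defensive.

(* Let [F = PQ - QP] and let [P1], [P2] be the projections onto the
   intersections of ranges and of null spaces.  Harmony gives a dense set of
   vectors [F z + k] with [k] orthogonal to [F z] and [PQ(1 - P1) k = 0], while
   [PF = F(1 - P)] and [QF = F(1 - Q)] turn [|PQ F z|] into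
   [|F (1 - P)(1 - Q) z|].  With [U = 2P - 1], [V = 2Q - 1] and
   [W = (UV + VU)/2] one has [-4F^2 = 1 - W^2], so that [|2F u|] is the norm of
   [(1 - W^2)^(1/2) u]; this root commutes with [P] and [Q], hence
   [|PQ F z| <= N |F z|] where [N] is the norm of [(1 - P)(1 - Q)(1 - P2)].

   The Cauchy-Schwarz inequality, which would need the order of the algebra, is
   never used: maps that preserve the inner product are isometric, and [W] and
   projections are means of such maps. *)

(** * Inner product identities, and norm estimates without Cauchy-Schwarz *)

Section InnerProduct.
Context (R : realType) (A : cstarAlgType R) (H : hilbertModType A).
Implicit Types (x y z : H) (T S : H -> H).
Local Notation "<| x , y |>" := (hdot x y : A).

Lemma hdotDl x y z : <|x + y, z|> = <|x, z|> + <|y, z|>.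
Proof. by rewrite -hdot_star hdotDr cstarD !hdot_star. Qed.

Lemma hdotNr x y : <|x, - y|> = - <|x, y|>.
Proof. by rewrite -scaleN1r hdotZr scaleN1r. Qed.

Lemma hdotZl (c : R[i]) x y : <|c *: x, y|> = Num.conj c *: <|x, y|>.
Proof. by rewrite -hdot_star hdotZr cstarZ hdot_star. Qed.

Lemma hdotNl x y : <|- x, y|> = - <|x, y|>.
Proof. by rewrite -scaleN1r hdotZl rmorphN1 scaleN1r. Qed.

Lemma hdotBl x y z : <|x - y, z|> = <|x, z|> - <|y, z|>.
Proof. by rewrite hdotDl hdotNl. Qed.

Lemma hdotBr x y z : <|x, y - z|> = <|x, y|> - <|x, z|>.
Proof. by rewrite hdotDr hdotNr. Qed.

Lemma hdot0r x : <|x, 0|> = 0.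
Proof. by rewrite -(subrr 0) hdotBr subrr. Qed.

Lemma hdot0l x : <|0, x|> = 0.
Proof. by rewrite -(subrr 0) hdotBl subrr. Qed.

Lemma hdot_sym0 x y : <|x, y|> = 0 -> <|y, x|> = 0.
Proof.
move=> xy0; rewrite -hdot_star xy0 -[RHS](hdot0l 0) -[RHS]hdot_star.
by rewrite hdot0l.
Qed.

Lemma hdot_inj x y : (forall z, <|x, z|> = <|y, z|>) -> x = y.
Proof.
by move=> xy; apply/subr0_eq/(@hdot_eq0 _ A); rewrite hdotBl xy subrr.
Qed.

Lemma eq_hdot_norm x y : <|x, x|> = <|y, y|> -> `|x| = `|y|.
Proof.
move=> xy; have : `|x| ^+ 2 = `|y| ^+ 2 by rewrite !(@hnormE _ A) xy.
by move/eqP; rewrite eqrXn2// => /eqP.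
Qed.

(* [x - y] and [x + y] have the same norm, and [x] is their mean. *)
Lemma orthogonal_norm_le x y : <|x, y|> = 0 -> `|x| <= `|x + y|.
Proof.
move=> xy0; have yx0 := hdot_sym0 xy0.
have eqn : `|x - y| = `|x + y|.
  apply: eq_hdot_norm.
  by rewrite hdotBl !hdotBr hdotDl !hdotDr xy0 yx0 !subr0 !addr0 sub0r opprK
     add0r.
rewrite -(@ler_pMn2r _ 2)// -normrMn.
have -> : x *+ 2 = x + y + (x - y) by rewrite addrACA subrr addr0 mulr2n.
by apply: (le_trans (ler_normD _ _)); rewrite eqn mulr2n.
Qed.

Lemma is_adjoint_linear T S : is_adjoint T S -> linear T.
Proof.
move=> TS c x y; apply: hdot_inj => z.
by rewrite TS !hdotDl !hdotZl !TS.
Qed.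

Lemma isometry_norm T S x : is_adjoint T S -> S (T x) = x -> `|T x| = `|x|.
Proof. by move=> TS STx; apply: eq_hdot_norm; rewrite TS STx. Qed.

(** Polarization replaces Cauchy-Schwarz: with [t = s^-1 y], [4 <x, t>] is
    [<x + t, x + t> - <x - t, x - t>], and both terms have norm at most [4 |x|^2]. *)
Lemma symmetric_hdot_le x y (s : R[i]) : 0 < s -> <|x, y|> = <|y, x|> ->
  `|y| <= s * `|x| -> `|<|x, y|>| <= 2 * s * `|x| ^+ 2.
Proof.
move=> s0 xy ys; have sR : Num.conj s^-1 = s^-1.
  by apply/conj_Creal; rewrite ger0_real// invr_ge0 ltW.
pose t := s^-1 *: y.
have yt : y = s *: t by rewrite /t scalerA divff ?gt_eqF// scale1r.
have tx : <|t, x|> = <|x, t|> by rewrite /t hdotZl hdotZr sR xy.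
have tn : `|t| <= `|x|.
  by rewrite /t normrZ gtr0_norm ?invr_gt0// mulrC ler_pdivrMr// mulrC.
have eqd : <|x, t|> *+ 4 = <|x + t, x + t|> - <|x - t, x - t|>.
  rewrite !hdotBl !hdotBr !hdotDl !hdotDr tx.
  set a := <|x, x|>; set b := <|x, t|>; set c := <|t, t|>.
  rewrite (addrC b c) addrACA (_ : a - b - (b - c) = a + c - (b + b)); last first.
    by rewrite opprB addrACA opprD.
  by rewrite opprB (addrC (a + c)) addrACA subrr addr0 -!mulr2n -mulrnA.
have le2 u : `|u| <= `|x| *+ 2 -> `|<|u, u|>| <= `|x| ^+ 2 *+ 4.
  move=> ux; rewrite -(@hnormE _ A).
  have -> : `|x| ^+ 2 *+ 4 = (`|x| *+ 2) ^+ 2 by rewrite exprMn_n.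
  by rewrite lerXn2r// nnegrE ?mulrn_wge0.
have : `|<|x, t|>| *+ 4 <= `|x| ^+ 2 *+ 4 + `|x| ^+ 2 *+ 4.
  rewrite -normrMn eqd; apply: (le_trans (ler_normB _ _)).
  apply: lerD; apply: le2; rewrite mulr2n.
    by apply: (le_trans (ler_normD _ _)); rewrite lerD2l.
  by apply: (le_trans (ler_normB _ _)); rewrite lerD2l.
rewrite -mulrnDl lerMn2r/= => h.
rewrite yt hdotZr normrZ gtr0_norm// -mulrA mulrCA ler_pM2l//.
by rewrite mulr_natl mulr2n.
Qed.

End InnerProduct.

(** * Approximate square root of [1 - W^2] for a self-adjoint contraction [W] *)

Section SquareRoot.
Context (R : realType) (A : cstarAlgType R) (H : hilbertModType A).
Variable W : {linear H -> H}.
Hypothesis W_adj : is_adjoint W W.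
Hypothesis W_le : forall x, `|W x| <= `|x|.
Local Notation "<| x , y |>" := (hdot x y : A).
Local Open Scope complex_scope.

(** A fixed point [q = (W^2 + q^2) / 2] satisfies [(1 - q)^2 = 1 - W^2]. *)
Fixpoint sqrt_iter n : {linear H -> H} :=
  if n is m.+1 then
    [the {linear H -> H} of
      2^-1 \*: ((W \o W) \+ (sqrt_iter m \o sqrt_iter m))]
  else \0.

(** The same iteration with the scalar 1 in place of [W]; it majorizes the operators [sqrt_iter n]
    and their increments. *)
Fixpoint sqrt_iter_bound n : R :=
  if n is m.+1 then (1 + sqrt_iter_bound m ^+ 2) / 2 else 0.

Local Notation q := sqrt_iter.
Local Notation r := sqrt_iter_bound.

Lemma sqrt_iterS n x : q n.+1 x = 2^-1 *: (W (W x) + q n (q n x)).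
Proof. by []. Qed.

Lemma sqrt_iter_commute (T : {linear H -> H}) n x :
  (forall y, T (W y) = W (T y)) -> T (q n x) = q n (T x).
Proof.
move=> TW; elim: n x => [|n IH] x; first by rewrite /= linear0.
by rewrite !sqrt_iterS linearZ linearD /= !TW !IH.
Qed.

Lemma sqrt_iter_adj n : is_adjoint (q n) (q n).
Proof.
elim: n => [|n IH] x y; first by rewrite /= hdot0l hdot0r.
rewrite !sqrt_iterS hdotZl hdotZr !hdotDl !hdotDr !W_adj !IH.
by congr (_ *: _); apply: conj_Creal; rewrite ger0_real.
Qed.

Lemma sqrt_iter_bound01 n : 0 <= r n <= 1.
Proof.
elim: n => [|n /andP[r0 r1]] /=; first by rewrite lexx ler01.
have := sqr_ge0 (r n); have : r n ^+ 2 <= 1 by rewrite expr_le1.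
by move=> h1 h2; apply/andP; split; lra.
Qed.

Lemma sqrt_iter_norm n x : `|q n x| <= (r n)%:C * `|x|.
Proof.
elim: n x => [|n IH] x; first by rewrite /= normr0 mul0r.
have /andP[r0 _] := sqrt_iter_bound01 n.
rewrite sqrt_iterS /= normrZ gtr0_norm ?invr_gt0//.
rewrite rmorphM rmorphD rmorphXn fmorphV rmorph_nat rmorph1 /=.
rewrite [_ / 2]mulrC -mulrA ler_pM2l ?invr_gt0//.
rewrite (le_trans (ler_normD _ _))// mulrDl mul1r lerD//.
  exact: (le_trans (W_le _)).
apply: (le_trans (IH _)); rewrite expr2 -mulrA ler_wpM2l//.
by rewrite lecR.
Qed.

(** [q_(n+2) - q_(n+1)] is half of [q_(n+1) (q_(n+1) - q_n) + (q_(n+1) - q_n) q_n], and the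
    increments of [r] obey the same recursion. *)
Lemma sqrt_iter_step_norm n x :
  `|q n.+1 x - q n x| <= (r n.+1 - r n)%:C * `|x|.
Proof.
have rC m : 0 <= (r m)%:C :> R[i].
  by rewrite lecR; have /andP[] := sqrt_iter_bound01 m.
elim: n x => [|n IH] x.
  rewrite !subr0; exact: sqrt_iter_norm.
have d0 : 0 <= (r n.+1 - r n)%:C :> R[i].
  rewrite lecR /=; have := sqr_ge0 (r n - 1).
  by rewrite sqrrB expr1n mulr1 => h; lra.
have -> : q n.+2 x - q n.+1 x =
    2^-1 *: (q n.+1 (q n.+1 x - q n x) + (q n.+1 (q n x) - q n (q n x))).
  transitivity (2^-1 *: (W (W x) + q n.+1 (q n.+1 x)) -
                2^-1 *: (W (W x) + q n (q n x))); first by [].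
  by rewrite -scalerBr opprD addrACA subrr add0r (raddfB (q n.+1)) addrA subrK.
have -> : r n.+2 - r n.+1 =
    2^-1 * (r n.+1 * (r n.+1 - r n) + (r n.+1 - r n) * r n).
  have : r n.+1 = (1 + r n ^+ 2) / 2 by [].
  have -> : r n.+2 = (1 + r n.+1 ^+ 2) / 2 by [].
  by move: (r n.+1) (r n) => s t ->; field.
rewrite normrZ gtr0_norm ?invr_gt0// rmorphM rmorphD (rmorphM _ (r n.+1)).
rewrite (rmorphM _ (_ - _)) fmorphV rmorph_nat -mulrA ler_pM2l ?invr_gt0//.
rewrite (le_trans (ler_normD _ _))// mulrDl lerD//.
  apply: (le_trans (sqrt_iter_norm _ _)); rewrite -mulrA ler_wpM2l//.
apply: (le_trans (IH _)); rewrite -mulrA ler_wpM2l//.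
exact: sqrt_iter_norm.
Qed.

(** Increments all at least [e] would give [n e <= r n] for every [n], against [r n <= 1]. *)
Lemma sqrt_iter_bound_step e : 0 < e -> exists n, r n.+1 - r n < e.
Proof.
move=> e0; apply: contrapT => /forallNP h.
have step n : n%:R * e <= r n.
  elim: n => [|n IH]; first by rewrite mul0r.
  have /negP := h n; rewrite -leNgt -natr1 mulrDl mul1r => ?; lra.
have := archi_boundP (ltW (divr_gt0 ltr01 e0)); set n := Num.bound _.
rewrite ltr_pdivrMr// => ne; have := step n.
have /andP[_ r1] := sqrt_iter_bound01 n; lra.
Qed.

(* The Newton-Visser iteration for [1 - (1 - W^2)^(1/2)]; [b] is a polynomial
   in [W] which only approximates the square root, so no limit is taken. *)
Lemma approx_sqrt (e : R[i]) : 0 < e -> exists b : {linear H -> H},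
  (forall (T : {linear H -> H}) x,
     (forall y, T (W y) = W (T y)) -> T (b x) = b (T x)) /\
  (forall x, `|<|b x, b x|> - <|x, x - W (W x)|>| <= e * `|x| ^+ 2).
Proof.
move=> e0; have eE : e = (complex.Re e)%:C.
  by move: e0; case: e => a b; rewrite ltcE /= => /andP[/eqP-> _].
have e0' : 0 < complex.Re e by move: e0; rewrite eE ltcR.
(* The error will be [2 <x, d>] with [|d| <= (e / 4) |x|], and [symmetric_hdot_le] brings another
   factor 2; hence the tolerance [e / 4]. *)
have [n /ltW hn] := sqrt_iter_bound_step (divr_gt0 e0' (ltr0Sn R 3)).
exists [the {linear H -> H} of idfun \- q n]; split.
  by move=> T x TW; rewrite /= linearB /= sqrt_iter_commute.
move=> x /=; set d := q n.+1 x - q n x.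
have xd : <|x, d|> = <|d, x|> by rewrite hdotBl hdotBr !sqrt_iter_adj.
(* [(1 - q_n)^2 - (1 - W^2) = W^2 + q_n^2 - 2 q_n = 2 (q_(n+1) - q_n)]. *)
have -> : <|x - q n x, x - q n x|> - <|x, x - W (W x)|> = <|x, d|> *+ 2.
  have WE : W (W x) = q n.+1 x + q n.+1 x - q n (q n x).
    apply/eqP; rewrite eq_sym subr_eq sqrt_iterS -mulr2n -scaler_nat scalerA.
    by rewrite divff// scale1r.
  have qB y z : q n (y - z) = q n y - q n z by exact: raddfB.
  rewrite hdotBl sqrt_iter_adj -!hdotBr qB WE !opprB.
  rewrite mulr2n -hdotDr /d; move: (q n.+1 x) (q n (q n x)) (q n x) => f c a.
  rewrite (AC ((2*2)*4) ((1*8)*(3*7)*((5*2)*(6*4)))) /=.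
  by rewrite !subrr !add0r.
rewrite normrMn.
have hd : `|d| <= (complex.Re e / 4)%:C * `|x|.
  by apply: (le_trans (sqrt_iter_step_norm _ _)); rewrite ler_wpM2r// lecR.
have s0 : 0 < (complex.Re e / 4)%:C by rewrite ltcR divr_gt0.
have := symmetric_hdot_le s0 xd hd; rewrite -(@ler_pMn2r _ 2)// => h.
have -> : e = 2 * (complex.Re e / 4)%:C *+ 2.
  by rewrite {1}eE rmorphM fmorphV rmorph_nat; field.
by rewrite mulrnAl.
Qed.
End SquareRoot.

(** * Projections as linear maps, and existence of [P_M] *)

Section Projections.
Context (R : realType) (A : cstarAlgType R) (H : hilbertModType A).
Local Notation "<| x , y |>" := (hdot x y : A).

(** Bundles the linearity that [projection] only implies, so that additivity lemmas apply. *)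
Record linproj (P : {linear H -> H}) : Prop := LinProj {
  linproj_adj : is_adjoint P P;
  linprojK : forall x, P (P x) = P x }.

Lemma linproj_compl (P : {linear H -> H}) :
  linproj P -> linproj [the {linear H -> H} of idfun \- P].
Proof.
case=> Pa PK; split=> [x y|x] /=; first by rewrite hdotBl hdotBr Pa.
by rewrite raddfB /= PK subrr subr0.
Qed.

Lemma linproj_norm (P : {linear H -> H}) x : linproj P -> `|P x| <= `|x|.
Proof.
case=> Pa PK; rewrite -[x in leRHS](subrKC (P x)); apply: orthogonal_norm_le.
by apply: hdot_sym0; rewrite -Pa raddfB /= PK subrr hdot0l.
Qed.

Lemma projection_linear (P : H -> H) : projection P ->
  exists2 P' : {linear H -> H}, P = P' :> (H -> H) & linproj P'.
Proof.
case=> _ PK Pa.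
pose P' : {linear H -> H} :=
  HB.pack P (GRing.isLinear.Build _ _ _ _ P (is_adjoint_linear Pa)).
exists P' => //; split => // x; exact: (congr1 (@^~ x) PK).
Qed.

Lemma orthogonally_complementedE (M : set H) x :
  orthogonally_complemented M ->
  exists2 m, M m & exists2 n, Defs.orthogonal M n & m + n = x.
Proof. by move=> Mc; have : [set: H] x by []; rewrite -Mc. Qed.

(** Choosing a component [p x] in [M] for each [x] gives [<p x, y> = <p x, p y>], so [p] is
    self-adjoint, and it fixes [M]. Hence [proj_on] does not fall back on its default. *)
Lemma proj_onP (M : set H) : orthogonally_complemented M ->
  projection (proj_on M) /\ range (proj_on M) = M.
Proof.
move=> Mc.
have /choice[p hp] x : exists m, M m /\ Defs.orthogonal M (x - m).
  have [m Mm [n Mn <-]] := orthogonally_complementedE x Mc.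
  exists m; split=> //.
  by rewrite addrC addKr.
have pM x : M (p x) by case: (hp x).
have po x m : M m -> <|x - p x, m|> = 0 by case: (hp x) => _; apply.
have pid m : M m -> p m = m.
  move=> Mm; apply/esym/subr0_eq/(@hdot_eq0 _ A).
  by rewrite hdotBr !po// subrr.
have pdot x y : <|p x, y|> = <|p x, p y|>.
  apply/subr0_eq; rewrite -hdotBr; exact/hdot_sym0/po.
have padj : is_adjoint p p.
  move=> x y; rewrite pdot; apply/esym/subr0_eq; rewrite -hdotBl; exact: po.
apply: (@xgetPex (H -> H) idfun [set P | projection P /\ range P = M]).
exists p; split.
  split=> //; first by exists p.
  by apply/funext => x /=; rewrite pid.
apply/seteqP; split=> [_ [x _ <-]//|m Mm]; exists m => //; exact: pid.
Qed.

End Projections.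

(** * Decompositions and density statements drawn from harmony *)

Section Density.
Context (R : realType) (A : cstarAlgType R) (H : hilbertModType A).
Local Notation "<| x , y |>" := (hdot x y : A).
Implicit Types P Q : {linear H -> H}.

Lemma closure_approx (S : set H) x (e : R[i]) : closure S x -> 0 < e ->
  exists2 y, S y & `|x - y| < e.
Proof.
move=> Sx e0; have [y [Sy xy]] := Sx _ (nbhsx_ballx x e e0).
by exists y => //; rewrite -ball_normE in xy.
Qed.

(** If [x] were nonzero, some [y] in [S] would have [|x - y| < |x|], while orthogonality gives
    [|x| <= |x - y|]. *)
Lemma closure_orthogonal0 (S : set H) x : closure S x ->
  (forall y, S y -> <|x, y|> = 0) -> x = 0.
Proof.
move=> Sx xS; apply/eqP; rewrite -normr_eq0; apply/eqP/le_anti.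
rewrite normr_ge0 andbT real_leNgt//; apply/negP => /(closure_approx Sx)[y Sy].
apply/negP; rewrite -real_leNgt//; apply: orthogonal_norm_le.
by rewrite hdotNr xS// oppr0.
Qed.

Lemma linproj_compl_adj P x y : linproj P -> <|x, y - P y|> = <|x - P x, y|>.
Proof. by case=> Pa _; rewrite hdotBr hdotBl Pa. Qed.

(** For [m] orthogonal to the range, self-adjointness gives [u + v = 0] with [u = m - P m] and
    [v = m - Q m]. Then [<u, u> = <u, m> = - <v, m> = - <v, v> = - <u, u>], so [u = v = 0]. *)
Lemma range_compl_decomp P Q x : linproj P -> linproj Q ->
  orthogonally_complemented
    (closure (range ((idfun \- P) \+ (idfun \- Q)))) ->
  exists c m, [/\ x = c + m, closure (range ((idfun \- P) \+ (idfun \- Q))) c,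
    Defs.orthogonal (closure (range ((idfun \- P) \+ (idfun \- Q)))) m,
    P m = m & Q m = m].
Proof.
move=> hP hQ /(orthogonally_complementedE x)[c Rc [m Rm <-]]; exists c, m.
have mR a : <|m, (a - P a) + (a - Q a)|> = 0.
  by apply: Rm; apply: subset_closure; exists a.
have mPQ : (m - P m) + (m - Q m) = 0.
  by apply: (@hdot_inj _ A) => z;
    rewrite hdotDl -!linproj_compl_adj// -hdotDr mR hdot0l.
have u0 : m - P m = 0.
  have uE : m - P m = - (m - Q m) by apply/eqP; rewrite -addr_eq0 mPQ.
  have uu T : linproj T -> <|m - T m, m - T m|> = <|m - T m, m|>.
    move=> hT; rewrite linproj_compl_adj// raddfB /= (linprojK hT).
    by rewrite subrr subr0.
  have e1 := uu _ hP; have e2 := uu _ hQ.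
  have e3 : <|m - P m, m - P m|> = - <|m - P m, m - P m|>.
    by rewrite {1}e1 uE hdotNl -e2 !(hdotNl, hdotNr) opprK.
  apply: (@hdot_eq0 _ A); apply: (@scalerI _ _ (2 : R[i])) => //.
  by rewrite scaler0 scaler_nat mulr2n {1}e3 addNr.
split=> //; first by apply/eqP; rewrite eq_sym -subr_eq0 u0.
by apply/eqP; rewrite eq_sym -subr_eq0 -mPQ u0 add0r.
Qed.

(** When [n] is fixed by [P] and [Q], so is its component [c'] in the closed range; thus [c'] is
    orthogonal to that range and vanishes, and [n = m'] is orthogonal to [c]. *)
Lemma inter_range_compl P Q : linproj P -> linproj Q ->
  orthogonally_complemented
    (closure (range ((idfun \- P) \+ (idfun \- Q)))) ->
  orthogonally_complemented (range P `&` range Q).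
Proof.
move=> hP hQ hc; apply/seteqP; split=> // x _.
have [c [m [xE Rc Rm Pm Qm]]] := range_compl_decomp x hP hQ hc.
exists m; first by split; exists m.
exists c; last by rewrite addrC.
move=> n [[y _ <-] [y' _ yy']].
have Pn : P (P y) = P y by rewrite (linprojK hP).
have Qn : Q (P y) = P y by rewrite -yy' (linprojK hQ).
move: (P y) Pn Qn => {yy' y' y} n Pn Qn.
have [c' [m' [nE Rc' Rm' Pm' Qm']]] := range_compl_decomp n hP hQ hc.
suff -> : n = m' by apply: hdot_sym0; exact: Rm'.
rewrite nE [c'](closure_orthogonal0 Rc') ?add0r// => _ [a _ <-] /=.
have c'E : c' = n - m' by rewrite nE addrK.
have Pc : P c' = c' by rewrite c'E raddfB /= Pn Pm'.
have Qc : Q c' = c' by rewrite c'E raddfB /= Qn Qm'.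
by rewrite hdotDr !linproj_compl_adj// Pc Qc !subrr !hdot0l addr0.
Qed.

(** Density of the range of [(1 - P) + (1 - Q)] plus the vectors fixed by both maps, with explicit
    approximants. *)
Definition approx_decomposable (P Q : H -> H) := forall x (e : R[i]), 0 < e ->
  exists a m, [/\ P m = m, Q m = m & `|x - ((a - P a) + (a - Q a) + m)| < e].

Lemma range_compl_approx P Q : linproj P -> linproj Q ->
  orthogonally_complemented
    (closure (range ((idfun \- P) \+ (idfun \- Q)))) ->
  approx_decomposable P Q.
Proof.
move=> hP hQ hc x e e0.
have [c [m [-> Rc _ Pm Qm]]] := range_compl_decomp x hP hQ hc.
have [_ [a _ <-] ca] := closure_approx Rc e0.
by exists a, m; split=> //; rewrite opprD addrACA subrr addr0.
Qed.

(** The range and the kernel of [P - Q] have a dense sum: [P] is applied to the first approximation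
    of [x], [1 - P] to the second, and the results are added. *)
Lemma linproj_diff_dense P Q : linproj P -> linproj Q ->
  approx_decomposable P Q ->
  approx_decomposable (idfun \- P) (idfun \- Q) ->
  forall x (e : R[i]), 0 < e ->
  exists z w, P w = Q w /\ `|x - (P z - Q z + w)| < e.
Proof.
move=> hP hQ d1 d2 x e e0; have e2 : 0 < e / 2 by rewrite divr_gt0.
have [a [m [Pm Qm /= xm]]] := d1 x _ e2.
have [b [n [/= Pn Qn xn]]] := d2 x _ e2.
have kill T : n - T n = n -> T n = 0.
  by move/eqP; rewrite -subr_eq0 addrAC subrr sub0r oppr_eq0 => /eqP.
move/(kill P) in Pn; move/(kill Q) in Qn.
(* [(P - Q) z = P (1 - Q) a + (1 - P) Q b], which is what survives of the two approximations besides
   [m] and [n]. *)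
exists (a - Q a - Q b), (m + n).
split; first by rewrite !linearD /= Pm Qm Pn Qn.
have PP := linprojK hP; have QQ := linprojK hQ.
move: xm; set y := x - _ => xm; move: xn; set y' := x - _ => xn.
have PB u v : P (u - v) = P u - P v by exact: raddfB.
have PD u v : P (u + v) = P u + P v by exact: raddfD.
have Py : P y = P x - (P (a - Q a) + m).
  by rewrite /y PB (PD _ m) (PD (a - P a)) Pm (PB a (P a)) PP subrr add0r.
have Py' : y' - P y' = x - P x - (Q b - P (Q b) + n).
  rewrite /y' !subKr PB !PD PP Pn addr0.
  move: (P b) (P x) (P (Q b)) (Q b) => p px pq q; rewrite !opprD !opprK.
  rewrite [LHS](AC ((1*3)*(1*2)) ((1*5)*((3*7)*4)*(6*2))) /=.
  by rewrite subrr addr0.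
have Pz : P (a - Q a - Q b) = P (a - Q a) - P (Q b) by exact: raddfB.
have Qz : Q (a - Q a - Q b) = - Q b by rewrite !raddfB /= !QQ subrr sub0r.
have -> : x - (P (a - Q a - Q b) - Q (a - Q a - Q b) + (m + n)) =
    P y + (y' - P y').
  rewrite Py Py' Pz Qz; move: (P (a - Q a)) (P x) (P (Q b)) (Q b) => s px t q.
  rewrite !opprD !opprK.
  rewrite [RHS](AC ((1*2)*(2*3)) ((1*5)*(4*(((2*7)*6)*(3*8))))) /=.
  by rewrite subrr add0r.
rewrite (splitr e) (le_lt_trans (ler_normD _ _))// ltrD//.
  exact: le_lt_trans (linproj_norm _ hP) xm.
exact: le_lt_trans (linproj_norm _ (linproj_compl hP)) xn.
Qed.
End Density.

(** * Density for the commutator of two projections; reflections *)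

Section Commutator.
Context (R : realType) (A : cstarAlgType R) (H : hilbertModType A).
Local Notation "<| x , y |>" := (hdot x y : A).
Implicit Types P Q : {linear H -> H}.

Lemma complK (P : H -> H) : idfun \- (idfun \- P) = P.
Proof. by apply/funext => x /=; rewrite subKr. Qed.

(** The previous density for [P, Q] and for [P, 1 - Q] is combined through
    [(P - Q) (P + Q - 1) = P Q - Q P]; moreover [P - Q] preserves the kernel of [P + Q - 1]. *)
Lemma comm_dense P Q : linproj P -> linproj Q ->
  approx_decomposable P Q ->
  approx_decomposable (idfun \- P) (idfun \- Q) ->
  approx_decomposable P (idfun \- Q) ->
  approx_decomposable (idfun \- P) Q ->
  forall x (e : R[i]), 0 < e -> exists z v w,
  [/\ P v = v - Q v, P w = Q w &
      `|x - ((P (Q z) - Q (P z)) + (v + w))| < e].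
Proof.
move=> hP hQ d1 d2 d3 d4 x e e0.
have e2 : 0 < e / 2 by rewrite divr_gt0.
(* The second error is seen through [P - Q], which at most doubles it. *)
have e4 : 0 < e / 4 by rewrite divr_gt0.
have [y [w [Pw xw]]] := linproj_diff_dense hP hQ d1 d2 x e2.
rewrite -{1}[Q : H -> H]complK in d4.
have [z [v [/= Pv yv]]] := linproj_diff_dense hP (linproj_compl hQ) d3 d4 y e4.
have PP := linprojK hP; have QQ := linprojK hQ.
have PB a b : P (a - b) = P a - P b by exact: raddfB.
have QB a b : Q (a - b) = Q a - Q b by exact: raddfB.
have PD a b : P (a + b) = P a + P b by exact: raddfD.
have QD a b : Q (a + b) = Q a + Q b by exact: raddfD.
have Qv : Q v = v - P v by rewrite Pv subKr.
have PQv : P (Q v) = 0 by rewrite Qv PB PP subrr.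
have QPv : Q (P v) = 0 by rewrite Pv QB QQ subrr.
exists z, (P v - Q v), w; split=> //.
  by rewrite PB QB PP QQ PQv QPv !subr0 sub0r opprK subrK.
set d := y - _ in yv; set f := x - _ in xw.
have -> : x - (P (Q z) - Q (P z) + (P v - Q v + w)) = f + (P d - Q d).
  have -> : P d - Q d = P y - Q y - (P (Q z) - Q (P z) + (P v - Q v)).
    have -> : P d = P y - (P (Q z) + P v).
      by rewrite /d /= PB PD (PB (P z)) (PB z) PP subKr.
    have -> : Q d = Q y - (Q (P z) + Q v).
      by rewrite /d /= QB QD (QB (P z)) (QB z) QQ subrr subr0.
    move: (P y) (Q y) (P (Q z)) (Q (P z)) (P v) (Q v) => *.
    rewrite !opprD !opprK.
    by rewrite [LHS](AC ((1*2)*(1*2)) ((1*4)*((2*5)*(3*6)))).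
  rewrite /f; move: (P (Q z) - Q (P z)) (P v - Q v) (P y - Q y) => a b c.
  rewrite !opprD [RHS](AC ((1*2)*(1*2)) ((2*4)*(1*(5*(6*3))))) /=.
  by rewrite addNr add0r.
have -> : e = e / 2 + (e / 4 + e / 4) by field.
rewrite (le_lt_trans (ler_normD _ _))// ltrD// (le_lt_trans (ler_normB _ _))//.
by rewrite ltrD// (le_lt_trans (linproj_norm _ _) yv).
Qed.

Definition reflection P : {linear H -> H} :=
  [the {linear H -> H} of (2 \*: P) \- idfun].

Lemma reflectionE P x : reflection P x = 2 *: P x - x.
Proof. by []. Qed.

Lemma linproj_reflectionE P x : P x = 2^-1 *: (x + reflection P x).
Proof. by rewrite reflectionE subrKC scalerA mulVf// scale1r. Qed.

Lemma reflectionK P x : linproj P -> reflection P (reflection P x) = x.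
Proof.
move=> hP; have PU : P (reflection P x) = P x.
  have PZ c u : P (c *: u) = c *: P u by exact: linearZ.
  by rewrite reflectionE raddfB /= PZ linprojK// scaler_nat mulr2n addrK.
by rewrite 2!reflectionE PU subKr.
Qed.

Lemma reflection_adj P : linproj P -> is_adjoint (reflection P) (reflection P).
Proof.
move=> [Pa _] x y; rewrite !reflectionE hdotBl hdotBr hdotZl hdotZr Pa.
by rewrite conjC_nat.
Qed.

Lemma reflection_norm P x : linproj P -> `|reflection P x| = `|x|.
Proof.
by move=> hP; apply: (isometry_norm (reflection_adj hP)); exact: reflectionK.
Qed.

Definition sym_prod (U V : {linear H -> H}) : {linear H -> H} :=
  [the {linear H -> H} of 2^-1 \*: ((U \o V) \+ (V \o U))].

Lemma sym_prodE U V x : sym_prod U V x = 2^-1 *: (U (V x) + V (U x)).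
Proof. by []. Qed.

End Commutator.

(** * Algebra of [F], [U], [V] and [W] *)

Section Reflections.
Context (R : realType) (A : cstarAlgType R) (H : hilbertModType A).
Local Notation "<| x , y |>" := (hdot x y : A).
Variables P Q : {linear H -> H}.
Hypotheses (hP : linproj P) (hQ : linproj Q).
Local Notation U := (reflection P).
Local Notation V := (reflection Q).
Local Notation W := (sym_prod U V).

Definition comm : {linear H -> H} :=
  [the {linear H -> H} of (P \o Q) \- (Q \o P)].
Local Notation F := comm.

Lemma commE x : F x = P (Q x) - Q (P x).
Proof. by []. Qed.

Let UK x : U (U x) = x. Proof. exact: reflectionK. Qed.
Let VK x : V (V x) = x. Proof. exact: reflectionK. Qed.
Let UD x y : U (x + y) = U x + U y. Proof. exact: raddfD. Qed.
Let VD x y : V (x + y) = V x + V y. Proof. exact: raddfD. Qed.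
Let UB x y : U (x - y) = U x - U y. Proof. exact: raddfB. Qed.
Let VB x y : V (x - y) = V x - V y. Proof. exact: raddfB. Qed.
Let UZ c x : U (c *: x) = c *: U x. Proof. exact: linearZ. Qed.
Let VZ c x : V (c *: x) = c *: V x. Proof. exact: linearZ. Qed.

Lemma sym_prod_adj : is_adjoint W W.
Proof.
move=> x y; rewrite !sym_prodE hdotZl hdotZr conj_Creal ?ger0_real//.
congr (_ *: _); rewrite hdotDl hdotDr !(reflection_adj hP) !(reflection_adj hQ).
by rewrite !(reflection_adj hP) addrC.
Qed.

Lemma sym_prod_norm x : `|W x| <= `|x|.
Proof.
rewrite sym_prodE normrZ gtr0_norm ?invr_gt0// mulrC ler_pdivrMr//.
rewrite (le_trans (ler_normD _ _))// !reflection_norm//.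
by rewrite mulr_natr mulr2n.
Qed.

(** Since [U^2 = 1], both sides are [(V + U V U) / 2] at [x]. It follows that [P] commutes with
    [W]. *)
Lemma reflectionl_sym_prod x : U (W x) = W (U x).
Proof. by rewrite !sym_prodE UZ UD !UK addrC. Qed.

Lemma reflectionr_sym_prod x : V (W x) = W (V x).
Proof. by rewrite !sym_prodE VZ VD !VK addrC. Qed.

Lemma reflection_comm x : U (V x) - V (U x) = 4 *: F x.
Proof.
have PB a b : P (a - b) = P a - P b by exact: raddfB.
have PZ c a : P (c *: a) = c *: P a by exact: linearZ.
have cancel (a b c : H) : a - c - (b - c) = a - b.
  by rewrite opprB addrA subrK.
have -> : U (V x) - V (U x) = 2 *: (P (V x) - V (P x)).
  have -> : V (U x) = 2 *: V (P x) - V x by rewrite [U x]reflectionE VB VZ.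
  by rewrite [U (V x)]reflectionE cancel -scalerBr.
have -> : P (V x) - V (P x) = 2 *: F x.
  have -> : P (V x) = 2 *: P (Q x) - P x by rewrite [V x]reflectionE PB PZ.
  by rewrite [V (P x)]reflectionE cancel -scalerBr commE.
by rewrite scalerA -natrM.
Qed.

(** [(UV + VU)^2 - (UV - VU)^2 = 2 (UVVU + VUUV) = 4], where [UV + VU = 2 W] and [UV - VU = 4 F]. *)
Lemma sym_prod_sqr x : x - W (W x) = - (4 *: F (F x)).
Proof.
have FE y : F y = 4^-1 *: (U (V y) - V (U y)).
  by rewrite reflection_comm scalerA mulVf// scale1r.
set a := U (V x); set b := V (U x).
have Vb : U (V b) = x by rewrite /b VK UK.
have Ua : V (U a) = x by rewrite /a UK VK.
have FZ c y : F (c *: y) = c *: F y by exact: linearZ.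
have WZ c y : W (c *: y) = c *: W y by exact: linearZ.
have WW : 4 *: W (W x) = U (V a) + x + (x + V (U b)).
  have -> : W x = 2^-1 *: (a + b) by [].
  rewrite WZ sym_prodE !scalerA (_ : 4 * 2^-1 / 2 = 1); last by field.
  by rewrite scale1r (VD a) (UD (V a)) (UD a) (VD (U a)) Vb Ua.
have FF : 16 *: F (F x) = U (V a) - x - (x - V (U b)).
  have -> : F x = 4^-1 *: (a - b) by exact: FE.
  rewrite FZ FE !scalerA (_ : 16 / 4 / 4 = 1); last by field.
  by rewrite scale1r (VB a) (UB (V a)) (UB a) (VB (U a)) Vb Ua.
apply: (@scalerI _ _ (4 : R[i])) => //.
have -> : 4 *: - (4 *: F (F x)) = - (16 *: F (F x)).
  by rewrite scalerN scalerA -natrM.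
rewrite scalerBr WW FF.
move: (U (V a)) (V (U b)) => c d; rewrite !opprD !opprK.
rewrite scaler_nat !mulrS mulr0n addr0 !addrA.
rewrite [LHS](AC 8 ((1*6)*(2*7)*(5*3*4*8))) /=.
by rewrite !subrr !add0r.
Qed.

Lemma comm_skew x y : <|F x, y|> = - <|x, F y|>.
Proof.
by rewrite !commE hdotBl hdotBr !(linproj_adj hP, linproj_adj hQ) opprB.
Qed.

Lemma comm_sqr_norm x : <|2 *: F x, 2 *: F x|> = <|x, x - W (W x)|>.
Proof.
rewrite sym_prod_sqr hdotNr hdotZl !hdotZr conj_Creal ?ger0_real//.
by rewrite comm_skew !scalerN scalerA -natrM.
Qed.

(** Both sides are [P Q (1 - P) x]. *)
Lemma proj_comml x : P (F x) = F (x - P x).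
Proof.
have FB a b : F (a - b) = F a - F b by exact: raddfB.
have PB a b : P (a - b) = P a - P b by exact: raddfB.
by rewrite FB !commE PB !(linprojK hP) opprB addrA subrK.
Qed.

(** Both sides are [- Q P (1 - Q) x]. *)
Lemma proj_commr x : Q (F x) = F (x - Q x).
Proof.
have FB a b : F (a - b) = F a - F b by exact: raddfB.
have QB a b : Q (a - b) = Q a - Q b by exact: raddfB.
by rewrite FB !commE QB !(linprojK hQ) opprB [RHS]addrC addrA subrK.
Qed.

End Reflections.

(** Removes approximation errors. The order on complex numbers is partial; realness turns the
    failure of [x <= y] into [y < x]. *)
Lemma le_addM_gt0 (K : numFieldType) (x y c : K) :
  x \is Num.real -> y \is Num.real -> 0 <= c ->
  (forall e, 0 < e -> x <= y + e * c) -> x <= y.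
Proof.
move=> xr yr c0 h; rewrite real_leNgt//; apply/negP => yx.
have c1 : 0 < c + 1 by rewrite ltr_wpDl.
have d0 : 0 < x - y by rewrite subr_gt0.
(* The choice [e = (x - y) / (c + 1)] also covers [c = 0] and leads to [c + 1 <= c]. *)
have := h _ (divr_gt0 d0 c1).
rewrite -lerBlDl mulrAC ler_pdivlMr// ler_pM2l// => c1c.
by have := ltr_pwDr ltr01 c1c; rewrite ltxx.
Qed.

(** * Transfer of a norm bound from [(1 - P)(1 - Q)(1 - P2)] to [P Q (1 - P1)] *)

Section Bound.
Context (R : realType) (A : cstarAlgType R) (H : hilbertModType A).
Local Notation "<| x , y |>" := (hdot x y : A).
Variables P Q P1 P2 : {linear H -> H}.
Hypotheses (hP : linproj P) (hQ : linproj Q).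
Hypotheses (hP1 : linproj P1) (hP2 : linproj P2).
Hypotheses (PP1 : forall x, P (P1 x) = P1 x) (QP1 : forall x, Q (P1 x) = P1 x).
Hypothesis P1_id : forall x, P x = x -> Q x = x -> P1 x = x.
Hypotheses (PP2 : forall x, P (P2 x) = 0) (QP2 : forall x, Q (P2 x) = 0).
Local Notation F := (comm P Q).
Local Notation W := (sym_prod (reflection P) (reflection Q)).

Let LB (T : {linear H -> H}) x y : T (x - y) = T x - T y.
Proof. exact: raddfB. Qed.

Let L0 (T : {linear H -> H}) : T 0 = 0.
Proof. exact: raddf0. Qed.

Let LD (T : {linear H -> H}) x y : T (x + y) = T x + T y.
Proof. exact: raddfD. Qed.

(** [P Q F z] is [F] at [cc z = (1 - P)(1 - Q) z]. Up to [e |x|^2], [|2 F x|^2] is [|b x|^2] for a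
    [b] commuting with [P], [Q] and [P2], and [b (cc z) = cc (b z)] has norm at most [N |b z|]. *)
Lemma comm_norm_bound (N : R[i]) : 0 <= N ->
  (forall y, `|(y - P2 y) - Q (y - P2 y) - P ((y - P2 y) - Q (y - P2 y))|
             <= N * `|y|) ->
  forall z, `|P (Q (F z))| <= N * `|F z|.
Proof.
move=> N0 hN z0.
(* [F] vanishes on the range of [P2], so [P2 z = 0] may be assumed; then [P2 (b z) = 0], and [hN] at
   [b z] bounds [cc (b z)]. *)
pose z := z0 - P2 z0.
have Fz : F z0 = F z.
  have FP2 : F (P2 z0) = 0 by rewrite commE PP2 QP2 !L0 addr0.
  by rewrite LB FP2 subr0.
have P2z : P2 z = 0 by rewrite /z LB (linprojK hP2) subrr.
rewrite Fz; clearbody z; clear Fz z0.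
pose cc y := y - Q y - P (y - Q y).
have PQF : P (Q (F z)) = F (cc z) by rewrite proj_commr// proj_comml.
have W_comm (T : {linear H -> H}) : linproj T ->
  (forall y, reflection T (W y) = W (reflection T y)) ->
  forall y, T (W y) = W (T y).
  move=> hT TW y; rewrite !(linproj_reflectionE T) TW.
  by rewrite linearZ linearD.
have PW := W_comm P hP (reflectionl_sym_prod Q hP).
have QW := W_comm Q hQ (reflectionr_sym_prod P hQ).
(* Taking adjoints in [T P2 = 0] gives [P2 T = 0]; so [P2] commutes with the reflections and with
   [W]. *)
have P2T T : linproj T -> (forall x, T (P2 x) = 0) -> forall x, P2 (T x) = 0.
  move=> [Ta _] TP2 x; apply: (@hdot_inj _ A) => y.
  by rewrite (linproj_adj hP2) Ta TP2 hdot0r hdot0l.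
have LZ (T : {linear H -> H}) c x : T (c *: x) = c *: T x by exact: linearZ.
have P2_refl T : linproj T -> (forall x, T (P2 x) = 0) ->
    forall x, P2 (reflection T x) = reflection T (P2 x).
  by move=> hT T0 x; rewrite !reflectionE (LB P2) (LZ P2) (P2T _ hT T0) T0.
have P2W y : P2 (W y) = W (P2 y).
  by rewrite !sym_prodE (LZ P2) (LD P2) !(P2_refl _ hP PP2, P2_refl _ hQ QP2).
have sq x : `|2 *: F x| ^+ 2 = `|<|x, x - W (W x)|>|.
  by rewrite (hnormE (A := A)) comm_sqr_norm.
(* Passing from [F] to [b] at [cc z] costs [e |cc z|^2]; passing back at [z] costs [e N^2 |z|^2]. *)
have main e : 0 < e -> `|2 *: F (cc z)| ^+ 2 <=
    (N * `|2 *: F z|) ^+ 2 + e * (N ^+ 2 * `|z| ^+ 2 + `|cc z| ^+ 2).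
  move=> e0; have [b [bT bn]] :=
    approx_sqrt (sym_prod_adj hP hQ) (sym_prod_norm hP hQ) e0.
  have le1 x : `|2 *: F x| ^+ 2 <= `|b x| ^+ 2 + e * `|x| ^+ 2.
    rewrite sq -lerBlDl (hnormE (A := A) (b x)).
    by rewrite (le_trans (lerB_dist _ _))// distrC.
  have le2 x : `|b x| ^+ 2 <= `|2 *: F x| ^+ 2 + e * `|x| ^+ 2.
    rewrite sq -lerBlDl (hnormE (A := A) (b x)).
    by rewrite (le_trans (lerB_dist _ _)).
  have ccb : b (cc z) = cc (b z).
    by rewrite /cc !(LB b) -(bT P)// (LB b) -(bT Q).
  have lebz : `|b (cc z)| <= N * `|b z|.
    by have := hN (b z); rewrite (bT P2)// P2z L0 subr0 ccb.
  rewrite (le_trans (le1 _))// mulrDr addrA lerD2r.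
  rewrite (le_trans (y := N ^+ 2 * `|b z| ^+ 2))//.
    by rewrite -exprMn lerXn2r// nnegrE ?mulr_ge0.
  by rewrite exprMn (mulrCA e) -mulrDr ler_wpM2l// exprn_ge0.
have : `|2 *: F (cc z)| ^+ 2 <= (N * `|2 *: F z|) ^+ 2.
  apply: le_addM_gt0 main.
  - by rewrite ger0_real// exprn_ge0.
  - by rewrite ger0_real// exprn_ge0// mulr_ge0.
  - by rewrite addr_ge0 ?mulr_ge0 ?exprn_ge0.
rewrite ler_pXn2r ?nnegrE ?mulr_ge0// !normrZ mulrCA ler_pM2l ?normr_gt0//.
by rewrite PQF.
Qed.

(** On the dense set of vectors [y = F z + (v + w)], [P Q (1 - P1)] kills [v] and [w] and sends [y]
    to [P Q F z], while [|F z| <= |y|] by orthogonality. *)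
Lemma proj_bound (N : R[i]) : 0 <= N ->
  (forall x (e : R[i]), 0 < e -> exists z v w,
    [/\ P v = v - Q v, P w = Q w &
      `|x - ((P (Q z) - Q (P z)) + (v + w))| < e]) ->
  (forall y, `|(y - P2 y) - Q (y - P2 y) - P ((y - P2 y) - Q (y - P2 y))|
             <= N * `|y|) ->
  forall x, `|P (Q (x - P1 x))| <= N * `|x|.
Proof.
move=> N0 dense hN x.
pose T : {linear H -> H} := [the {linear H -> H} of P \o Q \o (idfun \- P1)].
have T1 y : `|T y| <= `|y|.
  rewrite (le_trans (linproj_norm _ hP))// (le_trans (linproj_norm _ hQ))//.
  exact: linproj_norm (linproj_compl hP1).
have P1P y : P1 (P y) = P1 y.
  apply: (@hdot_inj _ A) => u.
  by rewrite !(linproj_adj hP1) (linproj_adj hP) PP1.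
have P1Q y : P1 (Q y) = P1 y.
  apply: (@hdot_inj _ A) => u.
  by rewrite !(linproj_adj hP1) (linproj_adj hQ) QP1.
(* Replacing [x] by [y] costs [e] because [T] is a contraction, and [N e] because
   [|y| <= |x| + e]. *)
apply: (@le_addM_gt0 R[i] _ _ (N + 1)).
- exact: normr_real.
- by rewrite ger0_real// mulr_ge0.
- exact: addr_ge0.
move=> e e0; have [z [v [w [Pv Pw]]]] := dense x _ e0.
rewrite -commE; set y := F z + (v + w) => xy.
have Qv : Q v = v - P v by rewrite Pv subKr.
have PQv : P (Q v) = 0 by rewrite Qv (LB P) (linprojK hP) subrr.
have QPv : Q (P v) = 0 by rewrite Pv (LB Q) (linprojK hQ) subrr.
have Tv : T v = 0.
  (* [P1] applied to [P v = v - Q v] reads [P1 v = P1 v - P1 v]. *)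
  have P1v : P1 v = 0.
    have : P1 (P v) = P1 v - P1 (Q v) by rewrite Pv LB.
    by rewrite P1P P1Q subrr.
  by rewrite /T /= P1v subr0.
have Tw : T w = 0.
  (* [P w = Q w] lies in both ranges, so [P1] fixes it. *)
  have QPw : Q (P w) = P w by rewrite Pw (linprojK hQ).
  have P1w : P1 w = P w by rewrite -P1P P1_id// (linprojK hP).
  by rewrite /T /= P1w (LB Q) QPw -Pw subrr (L0 P).
(* [F] is skew-adjoint and kills [v] and [w]. *)
have Fvw : <|F z, v + w|> = 0.
  rewrite comm_skew// commE !(LD P, LD Q).
  rewrite PQv QPv !add0r -Pw (linprojK hP) Pw (linprojK hQ).
  by rewrite subrr hdot0r oppr0.
have Ty : T y = P (Q (F z)).
  rewrite (LD T (F z)) (LD T v) Tv Tw !addr0 /T /=.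
  have -> : P1 (F z) = 0 by rewrite commE LB P1P P1Q P1Q P1P subrr.
  by rewrite subr0.
have Ny : `|T y| <= N * `|y|.
  rewrite Ty (le_trans (comm_norm_bound N0 hN _))// ler_wpM2l//.
  exact: orthogonal_norm_le Fvw.
rewrite -[P _]/(T x) -(subrK y x) (LD T).
rewrite (le_trans (ler_normD _ _))//.
have y_le : `|y| <= `|x| + e.
  rewrite -[y](subKr x) (le_trans (ler_normB _ _))// lerD2l ltW//.
have := lerD (le_trans (T1 (x - y)) (ltW xy)) Ny => h; rewrite (le_trans h)//.
rewrite subrK mulrDr mulr1 addrA [leRHS]addrC lerD2l.
by rewrite [e * N]mulrC -mulrDr ler_wpM2l.
Qed.
End Bound.

(** * Operator norms and the projections onto the two intersections *)

Section OpNorm.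
Context (R : realType) (A : cstarAlgType R) (H : hilbertModType A).
Implicit Types P Q : H -> H.
Local Open Scope complex_scope.

Lemma ge0_complexRe (c : R[i]) : 0 <= c -> (complex.Re c)%:C = c.
Proof. by case: c => a b; rewrite lecE /= => /andP[/eqP-> _]. Qed.

(** Contractivity bounds the set whose supremum is [opnorm]; the unit vector [x / |x|] then gives
    the estimate. *)
Lemma opnorm_ge (T : {linear H -> H}) x : (forall y, `|T y| <= `|y|) ->
  `|T x| <= (opnorm (A := A) T)%:C * `|x|.
Proof.
move=> T1; have ub y : `|y| <= 1 -> complex.Re `|T y| <= opnorm (A := A) T.
  move=> y1; apply: ub_le_sup; last by exists y.
  exists 1 => _ [u u1 <-]; rewrite -lecR ge0_complexRe//.
  exact: le_trans (T1 _) u1.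
have [->|x0] := eqVneq x 0; first by rewrite raddf0 !normr0 mulr0.
rewrite -ler_pdivrMr ?normr_gt0//.
have := ub (`|x|^-1 *: x); rewrite normrZ normfV normr_id mulVf ?normr_eq0//.
rewrite -lecR ge0_complexRe// linearZ /= normrZ normfV normr_id mulrC.
by apply.
Qed.

Lemma opnorm_ge0 (T : {linear H -> H}) : (forall y, `|T y| <= `|y|) ->
  0 <= opnorm (A := A) T.
Proof.
move=> T1; apply: ub_le_sup.
  exists 1 => _ [u u1 <-]; rewrite -lecR ge0_complexRe//.
  exact: le_trans (T1 _) u1.
by exists 0 => /=; rewrite ?raddf0 normr0.
Qed.

Lemma opnorm_le (T : H -> H) (c : R) : 0 <= c ->
  (forall x, `|T x| <= c%:C * `|x|) -> opnorm (A := A) T <= c.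
Proof.
move=> c0 Tc; apply: ge_sup.
  by exists (complex.Re `|T 0|), 0 => //=; rewrite normr0.
move=> _ [u u1 <-]; rewrite -lecR ge0_complexRe// (le_trans (Tc _))//.
by rewrite ler_piMr// lecR.
Qed.

Lemma projection_compl P : projection (A := A) P ->
  projection (A := A) (idfun \- P).
Proof.
move=> /projection_linear[P' -> /linproj_compl[Pa PK]]; split=> //.
- by exists (idfun \- P').
- exact/funext.
Qed.

(** With null spaces written as ranges, complementing [P] and [Q] exchanges the two
    intersections. *)
Lemma null_spaceE P : projection (A := A) P ->
  null_space P = range (idfun \- P).
Proof.
move=> /projection_linear[P' -> hP']; apply/seteqP; split=> x.
  by move=> Px; exists x => //=; rewrite Px subr0.
by case=> y _ <-; rewrite /null_space /= raddfB /= (linprojK hP') subrr.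
Qed.

(** Complementing both projections reverses the order of the four conditions. *)
Lemma harmonious_compl P Q : harmonious (A := A) P Q ->
  harmonious (A := A) (idfun \- P) (idfun \- Q).
Proof. by case=> h1 h2 h3 h4; split; rewrite ?complK. Qed.

(** Replaces [proj_on] by a linear map with the properties that [proj_bound] asks of [P1]. *)
Lemma proj_on_range_inter P Q :
  projection (A := A) P -> projection (A := A) Q ->
  orthogonally_complemented (closure (range ((idfun \- P) \+ (idfun \- Q)))) ->
  exists P1 : {linear H -> H},
    [/\ proj_on (range P `&` range Q) = P1, linproj P1,
        forall x, P (P1 x) = P1 x, forall x, Q (P1 x) = P1 x &
        forall x, P x = x -> Q x = x -> P1 x = x].
Proof.
move=> /projection_linear[P' -> hP] /projection_linear[Q' -> hQ] hc.
have [p1 r1] := proj_onP (inter_range_compl hP hQ hc).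
have [P1 e1 hP1] := projection_linear p1; exists P1.
have r1' : range P1 = range P' `&` range Q' by rewrite -[RHS]r1 e1.
have mem x : (range P' `&` range Q') (P1 x) by rewrite -r1'; exists x.
split=> // x.
- by have [[y _ <-] _] := mem x; rewrite (linprojK hP).
- by have [_ [y _ <-]] := mem x; rewrite (linprojK hQ).
- move=> Px Qx; have [y _ <-] : range P1 x by rewrite r1'; split; exists x.
  by rewrite (linprojK hP1).
Qed.

(** Half of the equality; its hypotheses are stable under complementing both projections, which
    yields the other half. *)
Lemma opnorm_projections_le P Q : projection (A := A) P ->
  projection (A := A) Q -> harmonious (A := A) P Q ->
  opnorm (A := A) (P \o Q \o (idfun \- proj_on (range P `&` range Q))) <=
  opnorm (A := A) ((idfun \- P) \o (idfun \- Q) \o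
          (idfun \- proj_on (null_space P `&` null_space Q))).
Proof.
move=> hP hQ [h1 h2 h3 h4]; rewrite !null_spaceE//.
have [P1 [-> hP1 PP1 QP1 P1id]] := proj_on_range_inter hP hQ h4.
have [|P2 [-> hP2 PP2 QP2 _]] :=
  proj_on_range_inter (projection_compl hP) (projection_compl hQ).
  by rewrite !complK.
case/projection_linear: hP PP1 h1 h2 h3 h4 P1id PP2 =>
  P' -> hP PP1 h1 h2 h3 h4 P1id PP2.
case/projection_linear: hQ QP1 h1 h2 h3 h4 P1id QP2 =>
  Q' -> hQ QP1 h1 h2 h3 h4 P1id QP2.
have kill (T : {linear H -> H}) x : (idfun \- T) x = x -> T x = 0.
  by move/eqP; rewrite /= -subr_eq0 addrAC subrr sub0r oppr_eq0 => /eqP.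
pose T := [the {linear H -> H} of
  (idfun \- P') \o (idfun \- Q') \o (idfun \- P2)].
have T1 x : `|T x| <= `|x|.
  rewrite (le_trans (linproj_norm _ (linproj_compl hP)))//.
  rewrite (le_trans (linproj_norm _ (linproj_compl hQ)))//.
  exact: linproj_norm (linproj_compl hP2).
have N0 := opnorm_ge0 T1.
have eq_range (f g : H -> H) : f = g ->
    orthogonally_complemented (closure (range g)) ->
    orthogonally_complemented (closure (range f)) by move->.
apply: opnorm_le => //; apply: (@proj_bound _ _ _ P' Q' P1 P2) => //.
- by move=> x; apply: kill.
- by move=> x; apply: kill.
- by rewrite lecR.
(* The four densities come from [h4], [h1], [h3], [h2] in this order, after cancelling double
   complements. *)
- apply: comm_dense => //.
  + exact: range_compl_approx.
  + apply: (range_compl_approx (linproj_compl hP) (linproj_compl hQ)).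
    by apply: eq_range h1; apply/funext => x /=; rewrite !subKr.
  + apply: (range_compl_approx hP (linproj_compl hQ)).
    by apply: eq_range h3; apply/funext => x /=; rewrite subKr.
  + apply: (range_compl_approx (linproj_compl hP) hQ).
    by apply: eq_range h2; apply/funext => x /=; rewrite subKr.
- by move=> y; have := opnorm_ge y T1.
Qed.
End OpNorm.

Theorem lemma5p1 (R : realType) (A : cstarAlgType R) (H : hilbertModType A)
    (P Q : H -> H) (hP : projection P) (hQ : projection Q)
    (hPQ : harmonious P Q) :
  opnorm (P \o Q \o (idfun \- proj_on (range P `&` range Q))) =
  opnorm ((idfun \- P) \o (idfun \- Q) \o
          (idfun \- proj_on (null_space P `&` null_space Q))).
Proof.
apply/le_anti/andP; split; first exact: opnorm_projections_le.
(* The reverse inequality is the same one for [1 - P] and [1 - Q]. *)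
have := opnorm_projections_le (projection_compl hP) (projection_compl hQ)
  (harmonious_compl hPQ).
rewrite !null_spaceE//; try exact: projection_compl.
by rewrite !complK.
Qed.
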